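(* Let $N\ge 1$ and let $I_1,\ldots,I_N$ be positive integers. For every tensor $\mathcal{A}\in\mathbb{C}^{I_1\times\cdots\times I_N\times I_1\times\cdots\times I_N}$, the numerical range $W(\mathcal{A})$ is a convex subset of $\mathbb{C}$.
   Context: For $\mathcal{A}\in\mathbb{C}^{I_1\times\cdots\times I_N\times I_1\times\cdots\times I_N}$ and $\mathcal{X}\in\mathbb{C}^{I_1\times\cdots\times I_N}$, the Einstein product $\mathcal{A}*_N\mathcal{X}\in\mathbb{C}^{I_1\times\cdots\times I_N}$ is $(\mathcal{A}*_N\mathcal{X})_{i_1\ldots i_N}=\sum_{k_1,\ldots,k_N}a_{i_1\ldots i_Nk_1\ldots k_N}x_{k_1\ldots k_N}$. For $\mathcal{X},\mathcal{Y}\in\mathbb{C}^{I_1\times\cdots\times I_N}$, $\langle\mathcal{X},\mathcal{Y}\rangle=\sum_{i_1,\ldots,i_N}x_{i_1\ldots i_N}\overline{y_{i_1\ldots i_N}}$ and $\|\mathcal{X}\|=\langle\mathcal{X},\mathcal{X}\rangle^{1/2}$; $\mathcal{X}$ is a unit tensor if $\|\mathcal{X}\|=1$. The numerical range of $\mathcal{A}$ is $W(\mathcal{A})=\{\langle\mathcal{A}*_N\mathcal{X},\mathcal{X}\rangle:\mathcal{X}\in\mathbb{C}^{I_1\times\cdots\times I_N},\ \|\mathcal{X}\|=1\}$. *)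

(* Defs.v *)
From mathcomp Require Import all_boot all_order all_algebra.
From mathcomp Require Import all_classical all_reals convex.
From mathcomp.real_closed Require Import complex.

Set Implicit Arguments.
Unset Strict Implicit.
Unset Printing Implicit Defensive.

Import Order.TTheory GRing.Theory Num.Theory.

Local Open Scope classical_set_scope.
Local Open Scope ring_scope.
Local Open Scope complex_scope.

(* Indices are 0-based: the k-th mode has the index set 'I_(I k). *)
Definition multi_index (N : nat) (I : 'I_N -> nat) : predArgType :=
  {dffun forall k : 'I_N, 'I_(I k)}.

Definition tensor (R : realType) (N : nat) (I : 'I_N -> nat) : Type :=
  {ffun multi_index I -> R[i]}.

(* The dimensions I_1 x ... x I_M x J_1 x ... x J_N. *)
Definition cat_dims (M N : nat) (I : 'I_M -> nat) (J : 'I_N -> nat)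
    (k : 'I_(M + N)) : nat :=
  match fintype.split k with inl a => I a | inr b => J b end.

(* The index i_1 ... i_M j_1 ... j_N. *)
Definition cat_index (M N : nat) (I : 'I_M -> nat) (J : 'I_N -> nat)
    (i : multi_index I) (j : multi_index J) : multi_index (cat_dims I J) :=
  [ffun k : 'I_(M + N) =>
     match fintype.split k as s
       return 'I_(match s with inl a => I a | inr b => J b end) with
     | inl a => i a
     | inr b => j b
     end].

Definition einstein_product (R : realType) (M N : nat)
    (I : 'I_M -> nat) (J : 'I_N -> nat)
    (A : tensor R (cat_dims I J)) (X : tensor R J) : tensor R I :=
  [ffun i => \sum_(k : multi_index J) A (cat_index i k) * X k].

Definition tensor_inner (R : realType) (N : nat) (I : 'I_N -> nat)
    (X Y : tensor R I) : R[i] :=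
  \sum_(i : multi_index I) X i * (Y i)^*.

Definition tensor_norm (R : realType) (N : nat) (I : 'I_N -> nat)
    (X : tensor R I) : R[i] :=
  sqrtC (tensor_inner X X).

Definition numerical_range (R : realType) (N : nat) (I : 'I_N -> nat)
    (A : tensor R (cat_dims I I)) : set R[i] :=
  [set z | exists2 X : tensor R I,
             tensor_norm X = 1 & z = tensor_inner (einstein_product A X) X].

(* Main.v *)
Require Import Defs.
From mathcomp Require Import all_boot all_order all_algebra.
From mathcomp Require Import all_classical all_reals convex.
From mathcomp.real_closed Require Import complex.
From mathcomp Require Import interval_inference ring.

(* This is the Toeplitz-Hausdorff theorem.  Let x and y be unit vectors with
   distinct values f(x,x) and f(y,y) of a sesquilinear form f; subtracting a
   multiple of the inner product h and rescaling, assume f(x,x) = 1 and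
   f(y,y) = 0.  For a suitable scalar c, the cross term of f on r x + c y is
   real for all real r, so that f(u,u) = s h(u,u), with u = r x + c y, is a real
   quadratic equation in r.  For 0 <= s < 1 its leading coefficient 1 - s is
   positive and its constant term is nonpositive, hence it has a real root. *)

Set Implicit Arguments.
Unset Strict Implicit.
Unset Printing Implicit Defensive.

Import Order.TTheory GRing.Theory Num.Theory.

Local Open Scope ring_scope.

(** The discriminant is a sum of nonnegative terms, so the quadratic formula gives a real root. *)
Lemma real_quadratic_root (C : numClosedFieldType) (a b c : C) :
  0 < a -> b \is Num.real -> 0 <= c ->
  exists2 r, r \is Num.real & a * r ^+ 2 + b * r - c = 0.
Proof.
move=> a_gt0 b_real c_ge0.
pose d := b ^+ 2 + 4 * a * c.
have d_ge0 : 0 <= d.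
  by rewrite addr_ge0 ?real_exprn_even_ge0 // !mulr_ge0 // ltW.
exists ((sqrtC d - b) / (2 * a)).
  by rewrite realM ?realV ?realB ?realM // ger0_real ?sqrtC_ge0 ?ler0n // ltW.
have sqr_d : sqrtC d ^+ 2 = b ^+ 2 + 4 * a * c by rewrite sqrtCK.
have a_neq0 : a != 0 by rewrite gt_eqF.
by field: sqr_d.
Qed.

Section Sesquilinear.
Variables (C : numClosedFieldType) (V : lmodType C).
Implicit Types (f h : V -> V -> C) (x y u v : V) (a b s : C).

Definition is_sesquilinear f :=
  (forall y, scalar (f^~ y)) /\
  (forall x, GRing.linear_for (Num.conj \; *%R) (f x)).

Definition is_inner_product h :=
  [/\ is_sesquilinear h, forall x y, h y x = (h x y)^*
    & forall x, x != 0 -> 0 < h x x].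

Lemma sesquilinear_diag f x y a b : is_sesquilinear f ->
  f (a *: x + b *: y) (a *: x + b *: y) =
    a * a^* * f x x + a * b^* * f x y + b * a^* * f y x + b * b^* * f y y.
Proof.
case=> fl fr.
(* Linearity with scalar -1 and both vectors 0 gives [f 0 z = - f 0 z + f 0 z]. *)
have f0l z : f 0 z = 0.
  by have := fl z (-1) 0 0; rewrite scaler0 addr0 mulN1r addNr.
have f0r z : f z 0 = 0.
  have /= := fr z (-1) 0 0; rewrite scaler0 addr0 rmorphN1 mulN1r.
  by rewrite addNr.
have fZr z c t : f z (c *: t) = c^* * f z t.
  by have /= := fr z c t 0; rewrite f0r !addr0.
have fZl z c t : f (c *: t) z = c * f t z.
  by have /= := fl z c t 0; rewrite f0l !addr0.
rewrite fl /= !fr /= !fZl !fZr.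
by ring.
Qed.

Lemma cross_term_real p q : exists2 c : C, c != 0 & c^* * p + c * q \is Num.real.
Proof.
have [->|qNp] := eqVneq q p^*.
  by exists 1; rewrite ?oner_eq0 // conjC1 !mul1r CrealE rmorphD /= conjCK addrC.
(* The sum becomes [q * q^* - p * p^*], and this scalar vanishes only in the case [q = p^*] treated
   above. *)
exists (q^* - p).
  by apply: contra_neq qNp => /eqP; rewrite subr_eq0 => /eqP <-; rewrite conjCK.
by rewrite CrealE; apply/eqP; rewrite !(rmorphD, rmorphM, rmorphB) /= !conjCK; ring.
Qed.

Lemma form_ratio_unit_interval f h x y s :
  is_sesquilinear f -> is_inner_product h ->
  f x x = 1 -> f y y = 0 -> h x x = 1 -> h y y = 1 -> 0 <= s <= 1 ->
  exists2 u, u != 0 & f u u = s * h u u.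
Proof.
move=> ff hh fx fy hx hy /andP[s_ge0 s_le1].
have [hf hC _] := hh.
have f0 : f 0 0 = 0.
  have := sesquilinear_diag 0 0 0 0 ff.
  by rewrite scale0r addr0 !mul0r !addr0.
have h0 : h 0 0 = 0.
  have := sesquilinear_diag 0 0 0 0 hf.
  by rewrite scale0r addr0 !mul0r !addr0.
(* At [s = 1] the quadratic would lose its leading term, but [x] itself is a solution. *)
have [->|sN1] := eqVneq s 1.
  exists x; last by rewrite fx hx mul1r.
  by apply/eqP => x0; move: hx; rewrite x0 h0 => /esym/eqP; rewrite oner_eq0.
have [c c_neq0 g_real] := cross_term_real (f x y) (f y x).
set g := _ + _ in g_real.
pose k := c^* * h x y + c * h y x.
have k_real : k \is Num.real.
  by rewrite CrealE /k (hC x y) rmorphD !rmorphM /= !conjCK addrC.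
have s_real := ger0_real s_ge0.
(* For [u = r *: x + c *: y] with [r] real, [f u u = r ^+ 2 + g * r] and
   [h u u = r ^+ 2 + k * r + c * c^*]; the quadratic is [f u u - s * h u u = 0]. *)
have [||| r r_real rP] :=
  @real_quadratic_root C (1 - s) (g - s * k) (s * (c * c^*)).
- by rewrite subr_gt0 lt_neqAle sN1.
- by rewrite realB ?realM.
- by rewrite mulr_ge0 ?mul_conjC_ge0.
exists (r *: x + c *: y); last first.
  rewrite !sesquilinear_diag // fx fy hx hy (conj_Creal r_real).
  by apply: subr0_eq; rewrite -[RHS]rP /g /k; ring.
(* If [u = 0], then [c *: y = - r *: x]. Evaluating [f] on both sides gives [0 = r ^+ 2], so
   [c *: y = 0] and [y = 0], against [h y y = 1]. *)
apply/eqP => u0.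
have r0 : r = 0.
  have : f (c *: y) (c *: y) = r ^+ 2.
    rewrite (_ : c *: y = (- r) *: x + 0 *: y).
      rewrite sesquilinear_diag // fx fy rmorphN /= (conj_Creal r_real) conjC0.
      by ring.
    by rewrite scale0r addr0 scaleNr; apply/eqP; rewrite -addr_eq0 addrC u0.
  have := sesquilinear_diag 0 y 0 c ff.
  rewrite scale0r add0r fy conjC0 !(mul0r, mulr0) !addr0 => -> /esym/eqP.
  by rewrite expf_eq0 => /andP[_ /eqP].
move: u0; rewrite r0 scale0r add0r => /eqP.
rewrite scaler_eq0 (negPf c_neq0) /= => /eqP y0.
by move: hy; rewrite y0 h0 => /esym/eqP; rewrite oner_eq0.
Qed.

Lemma toeplitz_hausdorff f h x y s :
  is_sesquilinear f -> is_inner_product h ->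
  h x x = 1 -> h y y = 1 -> 0 <= s <= 1 ->
  exists2 z, h z z = 1 & f z z = s * f x x + (1 - s) * f y y.
Proof.
move=> ff hh hx hy s01.
have [hf _ h_gt0] := hh.
have [fxy|fxNy] := eqVneq (f x x) (f y y).
  by exists x => //; rewrite fxy; ring.
have d_neq0 : f x x - f y y != 0 by rewrite subr_eq0.
(* This normalization takes the value 1 at [x] and 0 at [y]; [f1 u u = s * h u u] unwinds to the
   desired value of [f u u], up to the factor [h u u]. *)
pose f1 u v := (f u v - f y y * h u v) / (f x x - f y y).
have f1f : is_sesquilinear f1.
  case: ff hf => [fl fr] [hl hr]; split=> [v|v] a u w /=; rewrite /f1.
    by rewrite fl hl; ring.
  by rewrite fr hr /=; ring.
have [||u u_neq0] := form_ratio_unit_interval f1f hh _ _ hx hy s01.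
- by rewrite /f1 hx mulr1 divff.
- by rewrite /f1 hy mulr1 subrr mul0r.
move=> /(canRL (divfK d_neq0)) fu.
have hu_gt0 := h_gt0 u u_neq0.
pose a := (sqrtC (h u u))^-1.
have a_real : a \is Num.real by rewrite realV ger0_real // sqrtC_ge0 ltW.
have aa : a * a * h u u = 1.
  by rewrite /a -expr2 exprVn sqrtCK mulVf ?gt_eqF.
(* The zero summand only gives the vector [a *: u] the shape required by [sesquilinear_diag]. *)
exists (a *: u + 0 *: 0).
  by rewrite sesquilinear_diag // conjC0 (conj_Creal a_real) aa; ring.
rewrite sesquilinear_diag // conjC0 (conj_Creal a_real).
have -> : f u u = (s * f x x + (1 - s) * f y y) * h u u.
  by move/(canRL (subrK _)): fu => ->; ring.
by ring: aa.
Qed.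

End Sesquilinear.

Section Tensor.
Variables (R : realType) (N : nat) (I : 'I_N -> nat).

(* R[i]^o gives tensors their structure of vector space over R[i]. *)
Let ctensor : lmodType R[i] := {ffun multi_index I -> R[i]^o}.

Lemma tensor_inner_sesquilinear :
  @is_sesquilinear R[i] ctensor (@tensor_inner R N I).
Proof.
split=> [Y|X] a U W /=; rewrite /tensor_inner mulr_sumr -big_split /=;
  apply: eq_bigr => i _; rewrite !ffunE.
  by rewrite mulrDl mulrA.
by rewrite rmorphD rmorphM mulrDr mulrCA.
Qed.

Lemma tensor_inner_is_inner_product :
  @is_inner_product R[i] ctensor (@tensor_inner R N I).
Proof.
split=> [|X Y|X X_neq0]; first exact: tensor_inner_sesquilinear.
  rewrite /tensor_inner rmorph_sum; apply: eq_bigr => i _.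
  by rewrite rmorphM /= conjCK mulrC.
rewrite lt_neqAle sumr_ge0 ?andbT => [|i _]; last exact: mul_conjC_ge0.
(* A vanishing sum of nonnegative terms has only zero terms. *)
apply: contra_neq X_neq0 => /esym/eqP.
rewrite psumr_eq0 => [/allP X0|i _]; last exact: mul_conjC_ge0.
apply/ffunP => i; rewrite ffunE; apply/eqP.
by rewrite -mul_conjC_eq0; exact: X0 i (mem_index_enum i).
Qed.

Lemma einstein_product_linear (A : tensor R (cat_dims I I)) :
  @GRing.linear_for R[i] ctensor ctensor *:%R (einstein_product A).
Proof.
move=> a U W; apply/ffunP => i; rewrite !ffunE scaler_sumr -big_split /=.
by apply: eq_bigr => k _; rewrite !ffunE mulrDr mulrCA.
Qed.

Lemma einstein_form_sesquilinear (A : tensor R (cat_dims I I)) :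
  @is_sesquilinear R[i] ctensor
    (fun X Y => tensor_inner (einstein_product A X) Y).
Proof.
have [hl hr] := tensor_inner_sesquilinear; split=> [Y|X] a U W /=.
  by rewrite einstein_product_linear hl.
by rewrite hr.
Qed.

Lemma tensor_norm_eq1 (X : tensor R I) :
  tensor_norm X = 1 <-> tensor_inner X X = 1.
Proof.
rewrite /tensor_norm; split=> [|->]; last exact: sqrtC1.
by move=> /(congr1 (fun z => z ^+ 2)); rewrite sqrtCK expr1n.
Qed.

End Tensor.

(* Rcomplex R is R[i] with its structure of vector space over R. *)
Theorem theorem2p12 (R : realType) (N : nat) (hN : (1 <= N)%N)
    (I : 'I_N -> nat) (hI : forall k : 'I_N, (0 < I k)%N)
    (A : @tensor R (N + N) (cat_dims I I)) :
  @convex_set R (Rcomplex R) (numerical_range A).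
Proof.
move=> z w t; rewrite !inE => -[X /tensor_norm_eq1 hX ->].
move=> [Y /tensor_norm_eq1 hY ->].
have t01 : 0 <= (t%:num%:C)%C <= (1 : R[i]).
  by rewrite !lecR ge0 le1.
have [Z hZ fZ] := toeplitz_hausdorff (einstein_form_sesquilinear A)
  (tensor_inner_is_inner_product _ _) hX hY t01.
exists Z; first exact/tensor_norm_eq1.
(* The convex combination scales by reals, whereas [fZ] multiplies complex numbers. *)
have scaleE (a : R) (x : Rcomplex R) : a *: x = (a%:C)%C * x.
  by case: x => x1 x2; apply/eqP; rewrite eq_complex /= !mul0r subr0 addr0 !eqxx.
by rewrite fZ /conv /= !scaleE rmorphB.
Qed.
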